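(* Let $(\Omega,\mathcal{F},\mathbb{P})$ be a probability space with filtration $\mathcal{F}_0\subset\cdots\subset\mathcal{F}_T=\mathcal{F}$. For each $t=0,\dots,T-1$ let $(X_t,d_{X_t})$ be an $\mathcal{F}_t$-conditional metric space and let $d_t:X_t\to L^0_t(\mathbb{N})$ be $\mathcal{F}_t$-stable and sequentially continuous, where $L^0_t(\mathbb{N})$ carries the conditional discrete metric. Suppose that for each $t=0,\dots,T-1$, $\Theta_t$ assigns to each $x\in X_t$ a set $\Theta_t(x)$ such that (c1) $\emptyset\neq\Theta_t(x)\subset L^0_t(\mathbb{R})^{d_t(x)}$ for all $x\in X_t$; (c2) $\Theta_t\big(\sum_k1_{A_k}x_k\big)=\sum_k1_{A_k}\Theta_t(x_k)\subset L^0_t(\mathbb{R})^{d_t(\sum_k1_{A_k}x_k)}$ for all $(A_k)\in\Pi_{\mathcal{F}_t}$ and every sequence $(x_k)$ in $X_t$; (i) the set $\{(x,z):x\in X_t,\ z\in L^0_t(\mathbb{R})^{d_t(x)},\ z\in\Theta_t(x)\}$ is sequentially closed; (ii) for every sequence $(x_n)$ in $X_t$ with $x_n\to x\in X_t$ a.s. there exist $M\in L^0_{t,+}$, a measurable subsequence $n_1<n_2<\cdots$ in $L^0_t(\mathbb{N})$ and $k_0\in L^0_t(\mathbb{N})$ such that $\Theta_t(x_{n_k})\subset L^0_t(\mathbb{R})^{d_t(x)}$ for all $k\in L^0_t(\mathbb{N})$ with $k\ge k_0$, and $d_{L^0_t(\mathbb{R})^{d_t(x)}}(z,0)\le M$ for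 every $z\in\bigcup_{k\in L^0_t(\mathbb{N}),\,k\ge k_0}\Theta_t(x_{n_k})$. Then, for each $t=0,\dots,T-1$, $\Theta_t$ satisfies (c1), (c2) and also: (c3) for every $x\in X_t$ and every sequence $(z_n)$ in $\Theta_t(x)$ there exist $n_1<n_2<\cdots$ with $n_k\in L^0_t(\mathbb{N})$ and $z\in\Theta_t(x)$ such that $z_{n_k}\to z$ a.s.; (c4) for every sequence $(x_n)$ in $X_t$ with $x_n\to x\in X_t$ a.s. and every sequence $(z_n)$ with $z_n\in\Theta_t(x_n)$ for all $n$, there exist $n_1<n_2<\cdots$ with $n_k\in L^0_t(\mathbb{N})$ and $z_{n_k}\in L^0_t(\mathbb{R})^{d_t(x)}$ for all $k$, and a sequence $(z'_k)$ in $\Theta_t(x)$, such that $d_{L^0_t(\mathbb{R})^{d_t(x)}}(z_{n_k},z'_k)\to0$ a.s.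
   Context: Sets in $\mathcal{F}$ are identified if their symmetric difference is null, and functions on $\Omega$ are identified if they coincide a.s.; (in)equalities between random variables hold a.s. $\mathbb{N}=\{1,2,\dots\}$. For a sub-$\sigma$-algebra $\mathcal{G}$ of $\mathcal{F}$: $\Pi_{\mathcal{G}}$ is the set of countable partitions $(A_k)$ of $\Omega$ with all $A_k\in\mathcal{G}$; $L^0_{\mathcal{G},+}$ and $L^0_{\mathcal{G}}(\mathbb{N})$ are the spaces of $\mathcal{G}$-measurable random variables with values in $[0,\infty)$ and $\mathbb{N}$. The index $\mathcal{F}_t$ is abbreviated by $t$. A $\mathcal{G}$-conditional metric space is a nonempty set $X$ with a function $d:X\times X\to L^0_{\mathcal{G},+}$ such that (1) $d(x,y)=0$ iff $x=y$; (2) $d(x,y)=d(y,x)$; (3) $d(x,z)\le d(x,y)+d(y,z)$; (4) for every sequence $(x_k)$ in $X$ and $(A_k)\in\Pi_{\mathcal{G}}$ there is exactly one $x\in X$ with $1_{A_k}d(x,x_k)=0$ for all $k$, denoted $\sum_k1_{A_k}x_k$. Write $x_n\to x$ a.s. if $d(x,x_n)\to0$ a.s. A function $f$ is $\mathcal{G}$-stable if $f(\sum_k1_{A_k}x_k)=\sum_k1_{A_k}f(x_k)$ for all $(A_k)\in\Pi_{\mathcal{G}}$ and all sequences $(x_k)$, and sequentially continuous if $x_k\to x$ a.s. implies $f(x_k)\to f(x)$ a.s. The conditional discrete metric on $L^0_t(\mathbb{N})$ is $(m,n)\mapsto1_{\{m\ne n\}}$. Consequently, if $x_n\to x$ a.s.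 in $X_t$ there is $n_0\in L^0_t(\mathbb{N})$ such that for each $n\in\mathbb{N}$, $d_t(x_n)=d_t(x)$ on $\{n\ge n_0\}$. For a dimension $m=\sum_k1_{A_k}m_k\in L^0_t(\mathbb{N})$ with $m_k\in\mathbb{N}$ and $(A_k)\in\Pi_{\mathcal{F}_t}$, the conditional Euclidean space with measurable dimension $m$ is $$L^0_t(\mathbb{R})^m:=\Big\{\sum_k1_{A_k}x_k:x_k\in L^0_t(\mathbb{R}^{m_k})\text{ for all }k\Big\},$$ i.e. the set of (a.s. classes of) $\mathcal{F}_t$-measurable $x$ with $x(\omega)\in\mathbb{R}^{m(\omega)}$; its $\mathcal{F}_t$-conditional metric is $d_{L^0_t(\mathbb{R})^m}(x,\bar x)(\omega)=|x(\omega)-\bar x(\omega)|$, the Euclidean distance in $\mathbb{R}^{m(\omega)}$. Concatenations of elements of such spaces with different dimensions are formed pointwise: if $z_k\in L^0_t(\mathbb{R})^{m_k}$, with $m_k\in L^0_t(\mathbb{N})$, then $\sum_k1_{A_k}z_k$ equals $z_k$ on $A_k$ and belongs to $L^0_t(\mathbb{R})^{\sum_k1_{A_k}m_k}$; and $\sum_k1_{A_k}\Theta_t(x_k):=\{\sum_k1_{A_k}z_k:z_k\in\Theta_t(x_k)\text{ for all }k\}$. For a sequence $(x_n)$ and $m\in L^0_t(\mathbb{N})$, $x_m:=\sum_{j\in\mathbb{N}}1_{\{m=j\}}x_j$ (likewise for $z_m$). A measurable subsequence is given by $n_k\in L^0_t(\mathbb{N})$ with $n_k<n_{k+1}$ for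 all $k\in\mathbb{N}$; for $k\in L^0_t(\mathbb{N})$, $n_k:=\sum_{j\in\mathbb{N}}1_{\{k=j\}}n_j$. Sequential closedness in (i): if $x_n\to x$ a.s. in $X_t$, $z_n\in\Theta_t(x_n)$ for all $n$, and $z\in L^0_t(\mathbb{R})^{d_t(x)}$ is such that $z_n\to z$ a.s. (the Euclidean distance $|z_n-z|$ being defined on $\{d_t(x_n)=d_t(x)\}$, hence at a.e. $\omega$ for all large $n$), then $z\in\Theta_t(x)$. *)

(* Defs.v *)
From mathcomp Require Import all_boot all_order all_algebra.
From mathcomp Require Import all_classical all_reals all_analysis.

Set Implicit Arguments.
Unset Strict Implicit.
Unset Printing Implicit Defensive.

Import Order.TTheory GRing.Theory Num.Theory.
Import numFieldTopology.Exports numFieldNormedType.Exports.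

Local Open Scope classical_set_scope.
Local Open Scope ring_scope.

(* Classes of random variables modulo a.s. equality are handled through
   representatives: elements of L^0 spaces are functions on Omega, relations
   between them are a.s. relations, and sets of classes are sets of functions
   saturated for a.s. equality (see [L0_subset]).

   All sequences are indexed by nat, starting at 0, so a random index of a
   sequence is nat-valued ([L0_nat]), whereas dimensions are positive
   ([L0_dim]). *)

Section ConditionalSpaces.
Context (dO : measure_display) (Omega : measurableType dO) (R : realType).
Variables (P : probability Omega R) (G : set (set Omega)).

(* [<<s G >>], the sigma-algebra of [g_sigma_algebraType G], is [G] itself when
   [G] is a sigma-algebra. *)
Definition measurable_wrt dY (Y : measurableType dY) (f : Omega -> Y) : Prop :=
  measurable_fun [set: g_sigma_algebraType G] (f : g_sigma_algebraType G -> Y).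

(* Countable partitions; empty pieces are allowed, which covers the finite
   ones. *)
Definition partition_in (A : (set Omega)^nat) : Prop :=
  [/\ forall k, G (A k), trivIset setT A & \bigcup_k A k = setT].

Definition L0_nonneg (f : Omega -> R) : Prop :=
  measurable_wrt f /\ {ae P, forall w, 0 <= f w}.

Definition L0_nat (n : Omega -> nat) : Prop := measurable_wrt n.

Definition L0_dim (m : Omega -> nat) : Prop :=
  measurable_wrt m /\ {ae P, forall w, (0 < m w)%N}.

Definition is_concat (X : Type) (dX : X -> X -> Omega -> R)
    (A : (set Omega)^nat) (xs : nat -> X) (x : X) : Prop :=
  forall k, {ae P, forall w, \1_(A k) w * dX x (xs k) w = 0}.

Definition cvg_as (X : Type) (dX : X -> X -> Omega -> R)
    (xs : nat -> X) (x : X) : Prop :=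
  {ae P, forall w, dX x (xs n) w @[n --> \oo] --> (0 : R)}.

Record cond_metric_space (X : Type) (dX : X -> X -> Omega -> R) : Prop := {
  cms_inhabited : inhabited X;
  cms_nonneg : forall x y, L0_nonneg (dX x y);
  cms_separated : forall x y, {ae P, forall w, dX x y w = 0} <-> x = y;
  cms_sym : forall x y, {ae P, forall w, dX x y w = dX y x w};
  cms_triangle : forall x y z,
    {ae P, forall w, dX x z w <= dX x y w + dX y z w};
  cms_concat : forall (xs : nat -> X) (A : (set Omega)^nat),
    partition_in A -> exists! x, is_concat dX A xs x }.

Definition stable (X Y : Type) (dX : X -> X -> Omega -> R)
    (dY : Y -> Y -> Omega -> R) (f : X -> Y) : Prop :=
  forall (A : (set Omega)^nat) (xs : nat -> X) (x : X), partition_in A ->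
    is_concat dX A xs x -> is_concat dY A (f \o xs) (f x).

Definition seq_continuous (X Y : Type) (dX : X -> X -> Omega -> R)
    (dY : Y -> Y -> Omega -> R) (f : X -> Y) : Prop :=
  forall (xs : nat -> X) (x : X),
    cvg_as dX xs x -> cvg_as dY (f \o xs) (f x).

Definition discrete_dist (m n : Omega -> nat) : Omega -> R :=
  fun w => (m w != n w)%:R.

(* Points of the disjoint union of the spaces R^n are finite sequences of
   reals, with the disjoint-union sigma-algebra: on each event
   [size (z w) = n], all n coordinates are measurable. *)
Definition measurable_vec (z : Omega -> seq R) : Prop :=
  measurable_wrt (fun w => size (z w)) /\
  forall i, measurable_wrt (fun w => nth 0 (z w) i).

Definition L0_vec (m : Omega -> nat) : set (Omega -> seq R) :=
  [set z | measurable_vec z /\ {ae P, forall w, size (z w) = m w}].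

Definition L0_subset (S : set (Omega -> seq R)) (m : Omega -> nat) : Prop :=
  S `<=` L0_vec m /\
  forall z z', S z -> measurable_vec z' -> {ae P, forall w, z w = z' w} -> S z'.

(* Only used on vectors of equal size. *)
Definition euclid (u v : seq R) : R :=
  Num.sqrt (\sum_(i < size u) (nth 0 u i - nth 0 v i) ^+ 2).

Definition vec_dist (z z' : Omega -> seq R) : Omega -> R :=
  fun w => euclid (z w) (z' w).

Definition vec0 (m : Omega -> nat) : Omega -> seq R := fun w => nseq (m w) 0.

(* The distance [|z_n - z|] makes sense only where the dimensions agree, which
   has to happen for all large n, almost surely. *)
Definition vec_cvg_as (zs : nat -> Omega -> seq R) (z : Omega -> seq R) : Prop :=
  {ae P, forall w, (\forall n \near \oo, size (zs n w) = size (z w)) /\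
                   vec_dist (zs n) z w @[n --> \oo] --> (0 : R)}.

Definition concat_set (A : (set Omega)^nat)
    (S : nat -> set (Omega -> seq R)) : set (Omega -> seq R) :=
  [set z | measurable_vec z /\
    exists zs : nat -> Omega -> seq R, forall k,
      S k (zs k) /\ {ae P, forall w, A k w -> z w = zs k w}].

Definition meas_subseq (n : nat -> Omega -> nat) : Prop :=
  (forall k, L0_nat (n k)) /\
  forall k, {ae P, forall w, (n k w < n k.+1 w)%N}.

(* [at_idx dX xs m x] says that x is x_m, the concatenation of the x_j on the
   events [m = j]. *)
Definition at_idx (X : Type) (dX : X -> X -> Omega -> R)
    (xs : nat -> X) (m : Omega -> nat) (x : X) : Prop :=
  is_concat dX (fun j => m @^-1` [set j]) xs x.

(* The same for sequences of random variables, where it is pointwise. *)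
Definition rv_at (Y : Type) (zs : nat -> Omega -> Y) (m : Omega -> nat) :
  Omega -> Y := fun w => zs (m w) w.

Section Correspondence.
Variables (X : Type) (dX : X -> X -> Omega -> R) (dim : X -> Omega -> nat).
Variable Theta : X -> set (Omega -> seq R).

Definition nonempty_valued : Prop :=
  forall x, Theta x !=set0 /\ L0_subset (Theta x) (dim x).

Definition stable_correspondence : Prop :=
  forall (A : (set Omega)^nat) (xs : nat -> X) (x : X), partition_in A ->
    is_concat dX A xs x ->
    Theta x = concat_set A (Theta \o xs) /\
    concat_set A (Theta \o xs) `<=` L0_vec (dim x).

Definition graph : set (X * (Omega -> seq R)) :=
  [set p | L0_vec (dim p.1) p.2 /\ Theta p.1 p.2].

Definition graph_seq_closed : Prop :=
  forall (xs : nat -> X) (zs : nat -> Omega -> seq R) (x : X)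
         (z : Omega -> seq R),
    (forall n, graph (xs n, zs n)) -> L0_vec (dim x) z ->
    cvg_as dX xs x -> vec_cvg_as zs z -> graph (x, z).

Definition subseq_bounded : Prop :=
  forall (xs : nat -> X) (x : X), cvg_as dX xs x ->
    exists (M : Omega -> R) (n : nat -> Omega -> nat) (k0 : Omega -> nat),
      [/\ L0_nonneg M, meas_subseq n, L0_nat k0 &
        forall (k : Omega -> nat) (y : X),
          L0_nat k -> {ae P, forall w, (k0 w <= k w)%N} ->
          at_idx dX xs (rv_at n k) y ->
          Theta y `<=` L0_vec (dim x) /\
          forall z, Theta y z ->
            {ae P, forall w, vec_dist z (vec0 (dim x)) w <= M w}].

Definition seq_compact_valued : Prop :=
  forall (x : X) (zs : nat -> Omega -> seq R), (forall n, Theta x (zs n)) ->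
    exists (n : nat -> Omega -> nat) (z : Omega -> seq R),
      [/\ meas_subseq n, Theta x z & vec_cvg_as (fun k => rv_at zs (n k)) z].

Definition subseq_approximable : Prop :=
  forall (xs : nat -> X) (x : X) (zs : nat -> Omega -> seq R),
    cvg_as dX xs x -> (forall n, Theta (xs n) (zs n)) ->
    exists (n : nat -> Omega -> nat) (zs' : nat -> Omega -> seq R),
      [/\ meas_subseq n,
          forall k, L0_vec (dim x) (rv_at zs (n k)),
          forall k, Theta x (zs' k) &
          {ae P, forall w,
             vec_dist (rv_at zs (n k)) (zs' k) w @[k --> \oo] --> (0 : R)}].

End Correspondence.

End ConditionalSpaces.

Definition filtration (dO : measure_display) (Omega : measurableType dO)
    (T : nat) (F : nat -> set (set Omega)) : Prop :=
  [/\ forall t, (t <= T)%N -> sigma_algebra setT (F t),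
      forall s t, (s <= t <= T)%N -> F s `<=` F t &
      F T = measurable].

(* Main.v *)
(* Applying (ii) to random indices puts a random subsequence of the z_n, almost
   surely, into a bounded part of the conditional Euclidean space of dimension
   [dim x]. A conditional Bolzano-Weierstrass theorem then extracts a measurable
   convergent subsequence; since the z at a random index lies in Theta of the x
   at that index, by stability, the limit lies in Theta x, by closedness. So in
   (c4) the approximating sequence can be taken constant, and (c3) is the case
   of a constant sequence x_n.

   For Bolzano-Weierstrass, countably many cuts [z_k(i) < q], i a coordinate and
   q rational, are decided one after the other, always in favour of an answer
   given by infinitely many surviving indices. This needs no null sets, and the
   diagonal subsequence converges wherever it is bounded. *)
Require Import Defs.
From mathcomp Require Import all_boot all_order all_algebra.
From mathcomp Require Import all_classical all_reals all_analysis measurable_realfun.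

Set Implicit Arguments.
Unset Strict Implicit.
Unset Printing Implicit Defensive.

Import Order.TTheory GRing.Theory Num.Theory.
Import numFieldTopology.Exports numFieldNormedType.Exports.

Local Open Scope classical_set_scope.
Local Open Scope ring_scope.

(** * Measurable choice of indices *)

Section MeasurableSelection.
Context d (T : measurableType d).

Lemma measurable_fun_natP (n : T -> nat) :
  (forall k, measurable [set w | n w = k]) -> measurable_fun setT n.
Proof.
move=> mn _ Y _; rewrite setTI.
have -> : n @^-1` Y = \bigcup_(k in Y) [set w | n w = k].
  by apply/seteqP; split => [w Yw|w [k Yk /= nk]]; [exists (n w)|rewrite /preimage/= nk].
exact: bigcup_measurable.
Qed.

Lemma measurable_fun_eq_nat (n : T -> nat) k :
  measurable_fun setT n -> measurable [set w | n w = k].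
Proof. by move=> mn; rewrite -[X in measurable X]setTI; exact: (mn _ [set k]). Qed.

Lemma measurable_fun_at d' (Y : measurableType d') (f : nat -> T -> Y)
    (n : T -> nat) : measurable_fun setT n ->
  (forall k, measurable_fun setT (f k)) ->
  measurable_fun setT (fun w => f (n w) w).
Proof.
move=> mn mf _ B mB; rewrite setTI.
have -> : (fun w => f (n w) w) @^-1` B =
    \bigcup_k ([set w | n w = k] `&` (setT `&` f k @^-1` B)).
  by apply/seteqP; split => [w Bw|w [k _ [/= nk [_]]]]; [exists (n w)|rewrite /preimage/= nk].
apply: bigcup_measurable => k _; apply: measurableI.
  exact: measurable_fun_eq_nat.
exact: mf.
Qed.

(** The least admissible index works: it equals [k] exactly on [S k] minus the earlier [S j]. *)
Lemma measurable_selection_nat (S : nat -> set T) :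
  (forall k, measurable (S k)) -> (forall w, exists k, S k w) ->
  exists2 n : T -> nat, measurable_fun setT n & forall w, S (n w) w.
Proof.
move=> mS exS.
have exb w : exists k, `[< S k w >] by have [k Sk] := exS w; exists k; exact/asboolP.
exists (fun w => ex_minn (exb w)); last first.
  by move=> w; case: ex_minnP => k /asboolP.
apply: measurable_fun_natP => k.
have -> : [set w | ex_minn (exb w) = k] = S k `\` \bigcup_(j in `I_k) S j.
  apply/seteqP; split => [w /= <-|w [Sk nS] /=].
    case: ex_minnP => m /asboolP Sm min; split => // -[j /= jm Sj].
    by move: (min j); rewrite leqNgt jm => /(_ (asboolT Sj)).
  case: ex_minnP => m /asboolP Sm min; apply/eqP.
  rewrite eqn_leq min ?andTb; last exact/asboolP.
  by rewrite leqNgt; apply/negP => mk; apply: nS; exists m.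
by apply: measurableD => //; apply: bigcup_measurable.
Qed.

(* [refined B j k] is the event that the index [k] survives the first [j]
   choices, where the choice at stage [i] keeps the indices in [B i] if
   infinitely many survivors lie there, and those outside [B i] otherwise. *)
Fixpoint refined (B : nat -> nat -> set T) (j k : nat) : set T :=
  if j is i.+1 then
    let C := lim_sup_set (fun k => refined B i k `&` B i k) in
    refined B i k `&` ((B i k `&` C) `|` (~` B i k `&` ~` C))
  else setT.

Lemma measurable_refined B : (forall j k, measurable (B j k)) ->
  forall j k, measurable (refined B j k).
Proof.
move=> mB; elim=> [|j ih] k //=.
have mC : measurable (lim_sup_set (fun k => refined B j k `&` B j k)).
  apply: bigcap_measurableType => n _; apply: bigcup_measurable => m _.
  exact: measurableI.
apply: measurableI => //; apply: measurableU; apply: measurableI => //;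
  exact: measurableC.
Qed.

(** Induction on [j]: if infinitely many survivors lie in [B j], these are kept; otherwise the
    survivors past some index all lie outside [B j] and are kept. *)
Lemma refined_infinite B j w n :
  exists2 k, (n <= k)%N & refined B j k w.
Proof.
elim: j n => [|j ih] n /=; first by exists n.
set C := lim_sup_set _; have [Cw|nCw] := pselect (C w).
  have [k /= nk [rk Bk]] := Cw n I.
  by exists k => //; split => //; left.
have [m nCm] : exists m, ~ (exists2 k, (m <= k)%N & (refined B j k `&` B j k) w).
  apply: contrapT => /forallNP h; apply: nCw => m _.
  by have [k mk rk] := contrapT (h m); exists k.
have [k] := ih (maxn m n); rewrite geq_max => /andP[mk nk] rk.
exists k => //; split=> //; right; split=> // Bk.
by apply: nCm; exists k.
Qed.

Lemma refined_decr B i j k : (i <= j)%N -> refined B j k `<=` refined B i k.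
Proof.
move=> /subnK <-; elim: (j - i)%N => // m ih w /= [r _]; exact: ih.
Qed.

(** Diagonal argument: [l j] survives the first [j] choices, so each [B j] is answered alike by all
    [l k] with [k > j]. *)
Lemma measurable_deciding_subseq (B : nat -> nat -> set T) :
  (forall j k, measurable (B j k)) ->
  exists l : nat -> T -> nat,
    [/\ forall k, measurable_fun setT (l k),
        forall k w, (l k w < l k.+1 w)%N &
        forall j w, (\forall k \near \oo, B j (l k w) w) \/
                    (\forall k \near \oo, ~ B j (l k w) w)].
Proof.
move=> mB.
have /choice[N hN] : forall p : nat * nat, exists n : T -> nat,
    measurable_fun setT n /\
    forall w, (p.2 <= n w)%N /\ refined B p.1 (n w) w.
  move=> [j m] /=.
  have [| |n mn nS] := @measurable_selection_nat
      (fun k => [set w | (m <= k)%N] `&` refined B j k).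
  - move=> k; apply: measurableI; last exact: measurable_refined.
    by case: (m <= k)%N; rewrite ?set_true ?set_false.
  - by move=> w; have [k mk rk] := refined_infinite B j w m; exists k.
  by exists n; split => // w; have [] := nS w.
pose l := fix l j w := if j is i.+1 then N (j, (l i w).+1) w else N (0%N, 0%N) w.
have lr j w : refined B j (l j w) w by case: j => [|j]; exact: ((hN (_, _)).2 w).2.
have ml j : measurable_fun setT (l j).
  elim: j => [|j ih] /=; first exact: (hN _).1.
  (* The lower bound [(l j w).+1] is itself random, so [N] is evaluated at a random index. *)
  by apply: (measurable_fun_at (f := fun m w => N (j.+1, m.+1) w)) => // k;
    exact: (hN _).1.
exists l; split => // [k w|j w].
  exact: ((hN (k.+1, (l k w).+1)).2 w).1.
(* The choice concerning [B j] is made in passing to stage [j.+1]; it binds every later [l k]. *)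
have rj k : (j < k)%N -> refined B j.+1 (l k w) w.
  by move=> jk; apply: (refined_decr jk); exact: lr.
have [Cw|nCw] :=
  pselect (lim_sup_set (fun k => refined B j k `&` B j k) w); [left|right];
  by exists j.+1 => // k /= /rj [_ [] []].
Qed.

End MeasurableSelection.

(** * Convergence of bounded real sequences and of vectors *)

(** The limit is the supremum of the eventual lower bounds: a rational just above it is no such
    bound, so its cut is decided as [u n < ratr q]. *)
Lemma cvg_of_decided_cuts (R : realType) (u : R^nat) (M : R) :
  (forall n, `|u n| <= M) ->
  (forall q : rat, (\forall n \near \oo, u n < ratr q) \/
                   (\forall n \near \oo, ~ (u n < ratr q))) ->
  cvgn u.
Proof.
move=> uM cuts.
pose A := [set r : R | \forall n \near \oo, r <= u n].
have A0 : A !=set0.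
  by exists (- M); apply: nearW => n; have := uM n; rewrite ler_norml => /andP[].
have Aub : has_ubound A.
  exists M => r [n _ /(_ n (leqnn n))] /= rn; apply: (le_trans rn).
  by have := uM n; rewrite ler_norml => /andP[].
apply/cvg_ex; exists (sup A); apply/cvgrPdist_lt => e e0.
have [q] : exists q : rat, ratr q \in `]sup A, (sup A + e)[.
  by apply: rat_in_itvoo; rewrite ltrDl.
rewrite in_itv /= => /andP[Aq qe].
have [r Ar rA] : exists2 r, A r & sup A - e < r.
  by apply: sup_adherent => //; split.
have uq : \forall n \near \oo, u n < ratr q.
  case: (cuts q) => // h; suff : A (ratr q).
    by move/(ub_le_sup Aub); rewrite leNgt Aq.
  by apply: filterS h => n /negP; rewrite -leNgt.
near=> n; rewrite distrC ltr_distl; apply/andP; split.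
  by apply: lt_le_trans rA _; near: n.
by apply: lt_trans qe; near: n.
Unshelve. all: by end_near. Qed.

(** One square is at most the sum of squares; past the end, [nth] reads the default 0. *)
Lemma nth_le_euclid (R : realType) (u : seq R) d i : size u = d ->
  `|nth 0 u i| <= euclid u (nseq d 0).
Proof.
move=> ud; have [iu|ui] := ltnP i (size u); last first.
  by rewrite nth_default// normr0 sqrtr_ge0.
rewrite -sqrtr_sqr ler_wsqrtr// (bigD1 (Ordinal iu))//= nth_nseq -ud iu subr0.
by rewrite lerDl sumr_ge0// => j _; exact: sqr_ge0.
Qed.

Lemma cvg_euclid (R : realType) (u : nat -> seq R) (v : seq R) :
  (forall n, size (u n) = size v) ->
  (forall i, (i < size v)%N -> nth 0 (u n) i @[n --> \oo] --> nth 0 v i) ->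
  euclid (u n) v @[n --> \oo] --> (0 : R).
Proof.
move=> us uv; rewrite /euclid.
under eq_fun do rewrite us.
(* The target 0 is rewritten as the same expression at the limit, so that continuity applies. *)
suff : Num.sqrt (\sum_(i < size v) (nth 0 (u n) i - nth 0 v i) ^+ 2)
    @[n --> \oo] --> Num.sqrt (\sum_(i < size v) (nth 0 v i - nth 0 v i) ^+ 2).
  by under eq_bigr do rewrite subrr expr0n; rewrite big1// sqrtr0.
apply: continuous_cvg; first exact: sqrt_continuous.
apply: cvg_big => [|i _]; first exact: add_continuous.
by apply: cvgM; (apply: cvgB; [exact: uv|exact: cvg_cst]).
Qed.

(** * Conditional Bolzano-Weierstrass theorem *)

Section ConditionalCompactness.
Context (dO : measure_display) (Omega : measurableType dO) (R : realType).
Variables (P : probability Omega R) (G : set (set Omega)).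

Lemma measurable_wrt_rv_at dY (Y : measurableType dY) (f : nat -> Omega -> Y)
    (n : Omega -> nat) :
  measurable_wrt G n -> (forall k, measurable_wrt G (f k)) ->
  measurable_wrt G (rv_at f n).
Proof. exact: measurable_fun_at. Qed.

Lemma measurable_vec_rv_at (zs : nat -> Omega -> seq R) (n : Omega -> nat) :
  measurable_wrt G n -> (forall k, measurable_vec G (zs k)) ->
  measurable_vec G (rv_at zs n).
Proof.
move=> mn mz; split => [|i].
  exact: (@measurable_wrt_rv_at _ _ (fun k w => size (zs k w)) n mn
            (fun k => (mz k).1)).
exact: (@measurable_wrt_rv_at _ _ (fun k w => nth 0 (zs k w) i) n mn
          (fun k => (mz k).2 i)).
Qed.

Lemma conditional_bolzano_weierstrass (m : Omega -> nat) (M : Omega -> R)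
    (zs : nat -> Omega -> seq R) :
  measurable_wrt G m -> (forall k, L0_vec P G m (zs k)) ->
  (forall k, {ae P, forall w, vec_dist (zs k) (vec0 R m) w <= M w}) ->
  exists (l : nat -> Omega -> nat) (z : Omega -> seq R),
    [/\ forall k, L0_nat G (l k), forall k w, (l k w < l k.+1 w)%N,
        L0_vec P G m z & vec_cvg_as P (fun k => rv_at zs (l k)) z].
Proof.
move=> mm zsm zsM.
(* Stage [j] treats the cut coded by [j]; a number coding no pair gets the empty event. *)
pose B j k : set Omega := if unpickle j is Some (i, q)
  then [set w | nth 0 (zs k w) i < ratr q] else set0.
have mB j k : measurable (B j k : set (g_sigma_algebraType G)).
  rewrite /B; case: unpickle => [[i q]|] //.
  rewrite -[X in measurable X]setTI.
  have -> : [set w | nth 0 (zs k w) i < ratr q] =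
      (fun w => nth 0 (zs k w) i) @^-1` `]-oo, ratr q[%classic.
    by apply/seteqP; split => w; rewrite /= in_itv.
  by apply: (zsm k).1.2 => //; exact: measurable_itv.
have [l [ml incl lB]] := measurable_deciding_subseq mB.
(* The upper limit is defined and measurable everywhere, convergence or not; [fine] sends infinite
   values to 0. *)
pose c i w := fine (limn_esup (fun k => (nth 0 (rv_at zs (l k) w) i)%:E)).
pose z w := mkseq (c ^~ w) (m w).
have mrv k : measurable_vec G (rv_at zs (l k)).
  by apply: measurable_vec_rv_at; [exact: ml|move=> j; exact: (zsm j).1].
have mc i : measurable_wrt G (c i).
  apply: measurableT_comp; first exact: fine_measurable.
  apply: measurable_fun_limn_esup => k; apply/measurable_EFinP.
  exact: (mrv k).2.
have zE w i : nth 0 (z w) i = if (i < m w)%N then c i w else 0.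
  by case: ifPn => im; [rewrite nth_mkseq|rewrite nth_default// size_mkseq leqNgt].
exists l, z; split => //.
  split; last by apply: aeW => w; rewrite size_mkseq.
  split; first by under eq_fun do rewrite size_mkseq.
  move=> i; rewrite /measurable_wrt; under eq_fun do rewrite zE.
  apply: measurable_fun_ifT; [|exact: mc|exact: measurable_cst].
  by apply: measurable_fun_ltn; [exact: measurable_cst|exact: mm].
(* Countably many null sets are discarded at once, so size and bound also hold at the random index
   [l k w]. *)
have := ae_foralln (fun k => (zsm k).2); have := ae_foralln zsM.
apply: filterS2 => w zM zs_size.
have sz k : size (rv_at zs (l k) w) = size (z w) by rewrite zs_size size_mkseq.
split; first exact: nearW.
apply: cvg_euclid => // i; rewrite size_mkseq => im; rewrite zE im.
have : cvgn (fun k => nth 0 (rv_at zs (l k) w) i).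
  apply: (@cvg_of_decided_cuts _ _ (M w)) => [k|q].
    by apply: (le_trans _ (zM (l k w))); exact: nth_le_euclid (zs_size _).
  by have := lB (pickle (i, q)) w; rewrite /B pickleK.
move=> /cvg_ex[a ua]; suff -> : c i w = a by [].
suff ua' : (nth 0 (rv_at zs (l k) w) i)%:E @[k --> \oo] --> a%:E.
  by rewrite /c (cvg_limn_einf_sup ua').2.
by apply: cvg_EFin => //; exact: nearW.
Qed.

(** * Values of the correspondence at random indices and their limits *)

Section Selection.
Variables (X : Type) (dX : X -> X -> Omega -> R) (dim : X -> Omega -> nat).
Variable Theta : X -> set (Omega -> seq R).
Hypotheses (sG : sigma_algebra setT G) (hX : cond_metric_space P G dX).
Hypothesis hc1 : nonempty_valued P G dim Theta.
Hypothesis hc2 : stable_correspondence P G dX dim Theta.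

Lemma partition_in_preimage (m : Omega -> nat) :
  L0_nat G m -> partition_in G (fun j => m @^-1` [set j]).
Proof.
move=> mm; split.
- move=> k; rewrite -(sigma_algebra_id sG).
  exact: (@measurable_fun_eq_nat _ (g_sigma_algebraType G)).
- by move=> i j _ _ [w [/= <- <-]].
- by apply/seteqP; split => // w _; exists (m w).
Qed.

Lemma at_idx_exists (xs : nat -> X) (m : Omega -> nat) :
  L0_nat G m -> exists y, at_idx P dX xs m y.
Proof.
move=> mm; have [y [hy _]] := cms_concat hX xs (partition_in_preimage mm).
by exists y.
Qed.

(** On each event [m = k] the concatenation is [zs k], an element of [Theta (xs k)]; stability over
    this partition applies. *)
Lemma rv_at_section (xs : nat -> X) (zs : nat -> Omega -> seq R)
    (m : Omega -> nat) (y : X) : L0_nat G m ->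
  (forall n, Theta (xs n) (zs n)) -> at_idx P dX xs m y ->
  Theta y (rv_at zs m).
Proof.
move=> mm zsT ym.
rewrite (hc2 (partition_in_preimage mm) ym).1; split.
  by apply: measurable_vec_rv_at => // k; exact: ((hc1 (xs k)).2.1 _ (zsT k)).1.
by exists zs => k; split; [exact: zsT|apply: aeW => w /= <-].
Qed.

(** At almost every [w], [ys k] has distance 0 from [xs (m k w)], so by the triangle inequality it
    is no farther from [x]; and [m k w] is at least [k]. *)
Lemma cvg_as_at_idx (xs ys : nat -> X) (x : X) (m : nat -> Omega -> nat) :
  meas_subseq P G m -> (forall k, at_idx P dX xs (m k) (ys k)) ->
  cvg_as P dX xs x -> cvg_as P dX ys x.
Proof.
move=> [_ incm] ysm xsx.
have ae_ys : {ae P, forall w k, dX (ys k) (xs (m k w)) w = 0}.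
  apply: ae_foralln => k; have := ae_foralln (ysm k).
  by apply: filterS => w /(_ (m k w)); rewrite indicE mem_set// mul1r.
have ae_sym : {ae P, forall w k j, dX (xs j) (ys k) w = dX (ys k) (xs j) w}.
  by apply: ae_foralln => k; apply: ae_foralln => j; exact: cms_sym hX _ _.
have ae_tri : {ae P, forall w k j,
    dX x (ys k) w <= dX x (xs j) w + dX (xs j) (ys k) w}.
  by apply: ae_foralln => k; apply: ae_foralln => j; exact: cms_triangle hX _ _ _.
have ae_ge0 : {ae P, forall w k, 0 <= dX x (ys k) w}.
  by apply: ae_foralln => k; exact: (cms_nonneg hX _ _).2.
have ae_le : {ae P, forall w k, dX x (ys k) w <= dX x (xs (m k w)) w}.
  move: ae_ys ae_sym ae_tri; apply: filterS3 => w ysw symw triw k.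
  by apply: (le_trans (triw k (m k w))); rewrite symw ysw addr0.
have ae_cvg : {ae P, forall w, dX x (xs (m k w)) w @[k --> \oo] --> (0 : R)}.
  have := ae_foralln incm; move: xsx; apply: filterS2 => w xsw inc.
  apply: (cvg_comp (m ^~ w) (fun j => dX x (xs j) w) _ xsw) => A [N _ NA].
  exists N => // k /= Nk; apply: NA; apply: (leq_trans Nk).
  by elim: k {Nk} => // k ih; exact: leq_ltn_trans ih (inc k).
move: ae_ge0 ae_le ae_cvg; apply: filterS3 => w ge0 le cvg.
apply: squeeze_cvgr (cvg_cst 0) cvg.
by apply: nearW => k; rewrite ge0 le.
Qed.

Hypothesis hdim : forall x, L0_dim P G (dim x).
Hypothesis h_closed : graph_seq_closed P G dX dim Theta.
Hypothesis h_bounded : subseq_bounded P G dX dim Theta.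

(** Common core of (c3) and (c4): a single limit [z] in [Theta x] serves both. *)
Lemma subseq_of_selections_cvg (xs : nat -> X) (x : X)
    (zs : nat -> Omega -> seq R) :
  cvg_as P dX xs x -> (forall n, Theta (xs n) (zs n)) ->
  exists (n : nat -> Omega -> nat) (z : Omega -> seq R),
    [/\ meas_subseq P G n, forall k, L0_vec P G (dim x) (rv_at zs (n k)),
        Theta x z & vec_cvg_as P (fun k => rv_at zs (n k)) z].
Proof.
move=> xsx zsT; have [M [n [k0 [_ [mn incn] mk0 bnd]]]] := h_bounded xsx.
(* Adding [k0] makes every index admissible for [h_bounded]. *)
pose shift (k : Omega -> nat) w := (k0 w + k w)%N.
have mshift k : L0_nat G k -> L0_nat G (rv_at n (shift k)).
  by move=> mk; apply: measurable_wrt_rv_at => //; exact: measurable_fun_addn.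
(* Stated for random [k] because it serves twice: for the constants defining [vs], then for the
   extracted indices [l j]. *)
have shiftT k y : L0_nat G k -> at_idx P dX xs (rv_at n (shift k)) y ->
    [/\ Theta y (rv_at zs (rv_at n (shift k))),
        L0_vec P G (dim x) (rv_at zs (rv_at n (shift k))) &
        {ae P, forall w, vec_dist (rv_at zs (rv_at n (shift k)))
                           (vec0 R (dim x)) w <= M w}].
  move=> mk yk; have Ty := rv_at_section (mshift _ mk) zsT yk.
  have [|| sub bd] := bnd (shift k) y _ _ yk.
  - exact: measurable_fun_addn.
  - by apply: aeW => w; exact: leq_addr.
  by split => //; [exact: sub|exact: bd].
pose vs k := rv_at zs (rv_at n (shift (cst k))).
have mcst k : L0_nat G (cst k) by exact: measurable_cst.
have vsP k : L0_vec P G (dim x) (vs k) /\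
    {ae P, forall w, vec_dist (vs k) (vec0 R (dim x)) w <= M w}.
  have [y yk] := at_idx_exists xs (mshift _ (mcst k)).
  by have [] := shiftT _ _ (mcst k) yk.
have [l [z [ml incl zx cvgz]]] := conditional_bolzano_weierstrass
  (hdim x).1 (fun k => (vsP k).1) (fun k => (vsP k).2).
(* By computation [rv_at zs (m j)] is [rv_at vs (l j)], so [cvgz] speaks of it. *)
pose m j := rv_at n (shift (l j)).
have mm : meas_subseq P G m.
  split=> [j|j]; first exact: mshift.
  have := ae_foralln incn; apply: filterS => w inc.
  (* [l] may skip indices, so the increments of [n] at [w] are chained. *)
  have homo_n : {homo (fun i => n i w) : i j / (i < j)%N}.
    by apply: homo_ltn inc; exact: ltn_trans.
  by apply: homo_n; rewrite ltn_add2l.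
have /choice[ys ysP] : forall j, exists y, at_idx P dX xs (m j) y.
  by move=> j; exact: at_idx_exists (mm.1 j).
have ysT j := shiftT _ _ (ml j) (ysP j).
exists m, z; split => //; first by move=> j; have [] := ysT j.
(* Closedness is applied along [ys], the concatenations of [xs] at the indices [m j]. *)
have [] // := h_closed (xs := ys) (zs := fun j => rv_at zs (m j)) (x := x) (z := z).
  move=> j; have [Tj _ _] := ysT j.
  by split => //=; exact: (hc1 (ys j)).2.1.
exact: cvg_as_at_idx mm ysP xsx.
Qed.

End Selection.
End ConditionalCompactness.

Theorem proposition3p4 (R : realType) (dO : measure_display)
  (Omega : measurableType dO) (P : probability Omega R)
  (T : nat) (F : nat -> set (set Omega)) (hF : filtration T F)
  (X : 'I_T -> Type) (dX : forall t : 'I_T, X t -> X t -> Omega -> R)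
  (hX : forall t : 'I_T, cond_metric_space P (F t) (dX t))
  (dim : forall t : 'I_T, X t -> Omega -> nat)
  (hdim : forall (t : 'I_T) (x : X t), L0_dim P (F t) (dim t x))
  (hdim_stable : forall t : 'I_T,
     stable P (F t) (dX t) (@discrete_dist _ Omega R) (dim t))
  (hdim_cont : forall t : 'I_T,
     seq_continuous P (dX t) (@discrete_dist _ Omega R) (dim t))
  (Theta : forall t : 'I_T, X t -> set (Omega -> seq R))
  (hc1 : forall t : 'I_T, nonempty_valued P (F t) (dim t) (Theta t))
  (hc2 : forall t : 'I_T,
     stable_correspondence P (F t) (dX t) (dim t) (Theta t))
  (h_closed : forall t : 'I_T,
     graph_seq_closed P (F t) (dX t) (dim t) (Theta t))
  (h_bounded : forall t : 'I_T,
     subseq_bounded P (F t) (dX t) (dim t) (Theta t)) :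
  forall t : 'I_T,
    [/\ nonempty_valued P (F t) (dim t) (Theta t),
        stable_correspondence P (F t) (dX t) (dim t) (Theta t),
        seq_compact_valued P (F t) (Theta t) &
        subseq_approximable P (F t) (dX t) (dim t) (Theta t)].
Proof.
move=> t; have sF : sigma_algebra setT (F t) by case: hF => sF _ _; exact/sF/ltnW.
have sel := subseq_of_selections_cvg sF (hX t) (hc1 t) (hc2 t) (hdim t)
  (h_closed t) (h_bounded t).
split => //.
- move=> x zs zsT.
  have cst_x : cvg_as P (dX t) (fun=> x) x.
    have := (cms_separated (hX t) x x).2 erefl.
    by apply: filterS => w ->; exact: cvg_cst.
  by have [n [z [mn _ Tz cvgz]]] := sel _ _ _ cst_x zsT; exists n, z.
- move=> xs x zs xsx zsT; have [n [z [mn zsx Tz cvgz]]] := sel _ _ _ xsx zsT.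
  (* The second half of [cvgz] is the convergence of the distances to the constant sequence [z]. *)
  by exists n, (fun=> z); split => //; apply: filterS cvgz => w [].
Qed.
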